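(* The degree map $[\alpha_{ij}^{(g)}]\mapsto q^{-d_if_{ij}}t\mu_{ij}^{(g)}$, $[\varepsilon_i]\mapsto q^{2d_i}$ gives an isomorphism of abelian groups $\deg:\tilde G_f\simeq\Gamma'$.
   Context: Let $I$ be a finite set and $C=(c_{ij})_{i,j\in I}$ an irreducible symmetrizable generalized Cartan matrix: $c_{ii}=2$; $c_{ij}\in\mathbb{Z}_{\le 0}$ for $i\ne j$; $c_{ij}=0$ iff $c_{ji}=0$; there is $D=\mathrm{diag}(d_i\mid i\in I)$, $d_i\in\mathbb{Z}_{>0}$, with $DC$ symmetric (fixed); and, writing $i\sim j$ when $c_{ij}<0$, any two elements of $I$ are connected by a chain of $\sim$. For $i\sim j$ put $g_{ij}=\gcd(|c_{ij}|,|c_{ji}|)$, $f_{ij}=|c_{ij}|/g_{ij}$. $\Gamma$ is the multiplicative (free) abelian group generated by $q,t$ and $\mu_{ij}^{(g)}$ ($i\sim j$, $1\le g\le g_{ij}$) with relations $\mu_{ij}^{(g)}\mu_{ji}^{(g)}=1$. $\tilde Q$ is the quiver with vertex set $I$ and arrow set $\tilde Q_1=\{\alpha_{ij}^{(g)}\mid i,j\in I,\ i\sim j,\ 1\le g\le g_{ij}\}\cup\{\varepsilon_i\mid i\in I\}$, where $\alpha_{ij}^{(g)}$ goes from $j$ to $i$ and $\varepsilon_i$ is a loop at $i$. It is $\Gamma$-graded by $\deg(\alpha_{ij}^{(g)})=q^{-d_if_{ij}}t\mu_{ij}^{(g)}$, $\deg(\varepsilon_i)=q^{2d_i}$. $\Gamma'\subset\Gamma$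 is the subgroup generated by $\{\deg(a)\mid a\in\tilde Q_1\}$. $\tilde G$ is the multiplicative abelian group generated by the formal symbols $\{[a]\mid a\in\tilde Q_1\}$ subject to the relations $$[\alpha_{i_1j_1}^{(g_1)}][\alpha_{j_1i_1}^{(g_1)}][\varepsilon_{i_1}]^{f_{i_1j_1}}=[\alpha_{i_2j_2}^{(g_2)}][\alpha_{j_2i_2}^{(g_2)}][\varepsilon_{i_2}]^{f_{i_2j_2}}$$ for any $i_k,j_k\in I$ with $i_k\sim j_k$ and $1\le g_k\le g_{i_kj_k}$ ($k=1,2$). $\tilde G_f$ is the quotient of $\tilde G$ by its torsion subgroup. *)

(* Defs.v *)
(* All abelian groups are
   zmodTypes, hence written additively: q^a t mu reads q *+ a + t + mu. *)
From HB Require Import structures.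
From mathcomp Require Import all_boot all_order all_algebra.
From mathcomp Require Import generic_quotient ring_quotient.
From mathcomp Require Import boolp.
From mathcomp.multinomials Require Import freeg.

Set Implicit Arguments.
Unset Strict Implicit.
Unset Printing Implicit Defensive.

Import Order.TTheory GRing.Theory Num.Theory.
Local Open Scope ring_scope.
Local Open Scope quotient_scope.

Section AbelianGroups.
Variable V : zmodType.

Definition in_span (S : V -> Prop) : pred V :=
  fun v => `[< forall H : zmodClosed V,
                 (forall s, S s -> s \in H) -> v \in H >].

Fact in_span_closed S : zmod_closed (in_span S).
Proof.
split=> [|x y /asboolP hx /asboolP hy]; apply/asboolP => H SH.
  exact: rpred0.
by apply: rpredB; [exact: hx | exact: hy].
Qed.

HB.instance Definition _ S :=
  GRing.isZmodClosed.Build V (in_span S) (in_span_closed S).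

Definition subgroup_gen (S : V -> Prop) : zmodClosed V :=
  GRing.ZmodClosed.clone V (in_span S) _.

Definition is_torsion : pred V :=
  fun v => `[< exists2 n : nat, (0 < n)%N & v *+ n = 0 >].

Fact is_torsion_closed : zmod_closed is_torsion.
Proof.
split=> [|x y /asboolP[m m0 xm] /asboolP[n n0 yn]]; apply/asboolP.
  by exists 1%N.
exists (m * n)%N; first by rewrite muln_gt0 m0.
by rewrite mulrnBl mulrnA xm mul0rn mulnC mulrnA yn mul0rn subr0.
Qed.

HB.instance Definition _ :=
  GRing.isZmodClosed.Build V is_torsion is_torsion_closed.

Definition torsion : zmodClosed V := GRing.ZmodClosed.clone V is_torsion _.

Record subgroup_type (H : zmodClosed V) :=
  Subgroup { subgroup_val : V; _ : subgroup_val \in H }.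

HB.instance Definition _ (H : zmodClosed V) :=
  [isSub for @subgroup_val H].
HB.instance Definition _ (H : zmodClosed V) :=
  [Choice of subgroup_type H by <:].
HB.instance Definition _ (H : zmodClosed V) :=
  [SubChoice_isSubZmodule of subgroup_type H by <:].

End AbelianGroups.

(* Abelian group with generators X and relations r = 0 for r satisfying R. *)
Definition presented (X : choiceType) (R : {freeg X} -> Prop) : zmodType :=
  Quotient.quot (subgroup_gen R).

Definition presented_gen (X : choiceType) (R : {freeg X} -> Prop) (x : X) :
  presented R := \pi_(Quotient.quot (subgroup_gen R)) << x >>.

Definition mod_torsion (V : zmodType) : zmodType :=
  Quotient.quot (torsion V).

Definition to_mod_torsion (V : zmodType) (v : V) : mod_torsion V :=
  \pi_(Quotient.quot (torsion V)) v.

Section Cartan.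
Variables (I : finType) (C : I -> I -> int).

Definition gen_cartan : Prop :=
  [/\ forall i, C i i = 2,
      forall i j, i != j -> C i j <= 0
    & forall i j, C i j = 0 <-> C j i = 0].

(* d lists the diagonal entries of D; the second clause says D C = (D C)^T *)
Definition symmetrizer (d : I -> nat) : Prop :=
  (forall i, (0 < d i)%N) /\
  (forall i j, (d i)%:Z * C i j = (d j)%:Z * C j i).

Definition adj : rel I := fun i j => C i j < 0.

Definition irreducible_cartan : Prop := forall i j, connect adj i j.

Definition gmul (i j : I) : nat := gcdn `|C i j|%N `|C j i|%N.
Definition fdiv (i j : I) : nat := (`|C i j| %/ gmul i j)%N.

Fact gmulC i j : gmul i j = gmul j i.
Proof. exact: gcdnC. Qed.

(* The index 1 <= g <= g_ij is shifted to 0 <= g < g_ij throughout; this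
   reads g as an index for the pair (j, i). *)
Definition swapg i j : 'I_(gmul i j) -> 'I_(gmul j i) := cast_ord (gmulC i j).

(* Alpha ij g is the arrow alpha_ij^(g) from j to i, Eps i the loop at i *)
Inductive arrow : Type :=
  | Alpha (i j : I) of adj i j & 'I_(gmul i j)
  | Eps of I.

Inductive grading_gen : Type :=
  | GenQ
  | GenT
  | GenMu (i j : I) of adj i j & 'I_(gmul i j).

Let edge := {e : {p : I * I | adj p.1 p.2} & 'I_(gmul (val e).1 (val e).2)}.

Let mk_edge i j (ij : adj i j) (g : 'I_(gmul i j)) : edge :=
  existT (fun e : {p : I * I | adj p.1 p.2} => 'I_(gmul (val e).1 (val e).2))
    (exist (fun p : I * I => adj p.1 p.2) (i, j) ij) g.

Definition arrow_code (a : arrow) : edge + I :=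
  match a with Alpha i j ij g => inl (mk_edge ij g) | Eps i => inr i end.

Definition arrow_decode (x : edge + I) : arrow :=
  match x with
  | inl (existT (exist (i, j) ij) g) => @Alpha i j ij g
  | inr i => Eps i
  end.

Fact arrow_codeK : cancel arrow_code arrow_decode.
Proof. by case. Qed.

HB.instance Definition _ := Finite.copy arrow (can_type arrow_codeK).

Definition grading_gen_code (a : grading_gen) : edge + bool :=
  match a with
  | GenQ => inr true
  | GenT => inr false
  | GenMu i j ij g => inl (mk_edge ij g)
  end.

Definition grading_gen_decode (x : edge + bool) : grading_gen :=
  match x with
  | inl (existT (exist (i, j) ij) g) => @GenMu i j ij g
  | inr b => if b then GenQ else GenT
  end.

Fact grading_gen_codeK : cancel grading_gen_code grading_gen_decode.
Proof. by case. Qed.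

HB.instance Definition _ := Finite.copy grading_gen (can_type grading_gen_codeK).

Definition Gamma_rel (r : {freeg grading_gen}) : Prop :=
  exists (i j : I) (ij : adj i j) (ji : adj j i) (g : 'I_(gmul i j)),
    r = << GenMu ij g >> + << GenMu ji (swapg g) >>.

Definition Gamma : zmodType := presented Gamma_rel.

Definition q : Gamma := presented_gen Gamma_rel GenQ.
Definition t : Gamma := presented_gen Gamma_rel GenT.
Definition mu i j (ij : adj i j) (g : 'I_(gmul i j)) : Gamma :=
  presented_gen Gamma_rel (GenMu ij g).

Definition deg (d : I -> nat) (a : arrow) : Gamma :=
  match a with
  | Alpha i j ij g => - (q *+ (d i * fdiv i j)) + t + mu ij g
  | Eps i => q *+ (2 * d i)
  end.

Definition Gamma' (d : I -> nat) : zmodType :=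
  subgroup_type (subgroup_gen (fun x => exists a, x = deg d a)).

(* [alpha_ij^(g)] [alpha_ji^(g)] [eps_i]^f_ij *)
Definition potential_term i j (ij : adj i j) (ji : adj j i)
    (g : 'I_(gmul i j)) : {freeg arrow} :=
  << Alpha ij g >> + << Alpha ji (swapg g) >> + << Eps i >> *+ fdiv i j.

Definition Gtilde_rel (r : {freeg arrow}) : Prop :=
  exists (i1 j1 : I) (ij1 : adj i1 j1) (ji1 : adj j1 i1) (g1 : 'I_(gmul i1 j1))
         (i2 j2 : I) (ij2 : adj i2 j2) (ji2 : adj j2 i2) (g2 : 'I_(gmul i2 j2)),
    r = potential_term ij1 ji1 g1 - potential_term ij2 ji2 g2.

Definition Gtilde : zmodType := presented Gtilde_rel.

Definition Gtilde_f : zmodType := mod_torsion Gtilde.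

Definition bracket (a : arrow) : Gtilde_f :=
  to_mod_torsion (presented_gen Gtilde_rel a).

End Cartan.

(* Main.v *)
(* deg sends every term [alpha_ij][alpha_ji][eps_i]^f_ij to t^2, since
   d_i f_ij = d_j f_ji, so it is defined on the presented group; Gamma is torsion
   free, so it factors through the torsion quotient. Conversely, comparing the
   relations for (i, j) and (j, i) gives [eps_i]^f_ij = [eps_j]^f_ji, hence
   [eps_i]^d_j = [eps_j]^d_i modulo torsion by irreducibility. This yields a
   homomorphism back from Gamma whose composite with deg is multiplication by a
   positive integer (if I is nonempty), so deg is injective on the torsion-free
   quotient. *)
From HB Require Import structures.
From mathcomp Require Import all_boot all_order all_algebra.
From mathcomp Require Import generic_quotient ring_quotient boolp.
From mathcomp.multinomials Require Import freeg.
Require Import Defs.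
Import Order.TTheory GRing.Theory Num.Theory.
Set Implicit Arguments.
Unset Strict Implicit.
Unset Printing Implicit Defensive.
Local Open Scope ring_scope.
Local Open Scope quotient_scope.

(** * Generated subgroups, torsion, and universal properties *)

Lemma in_span_ind (V : zmodType) (S P : V -> Prop) :
  P 0 -> (forall x y, P x -> P y -> P (x - y)) -> (forall s, S s -> P s) ->
  forall x, x \in subgroup_gen S -> P x.
Proof.
move=> P0 PB SP x /asboolP xS.
(* [in_span] quantifies over all subgroups containing [S], so it suffices to turn [P] itself into
   one. *)
pose p : pred V := fun v => `[< P v >].
have p_closed : zmod_closed p.
  split=> [|y z /asboolP Py /asboolP Pz]; apply/asboolP; [exact: P0|exact: PB].
pose pc := GRing.isZmodClosed.Build V p p_closed.
pose H : zmodClosed V := HB.pack p pc.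
by apply/asboolP/(xS H) => s /SP Ps; apply/asboolP.
Qed.

Lemma mem_subgroup_gen (V : zmodType) (S : V -> Prop) s :
  S s -> s \in subgroup_gen S.
Proof. by move=> Ss; apply/asboolP => H; apply. Qed.

Definition torsion_free (V : zmodType) :=
  forall (x : V) n, (0 < n)%N -> x *+ n = 0 -> x = 0.

Lemma torsion_free_freeg (X : choiceType) : torsion_free {freeg X}.
Proof.
move=> x n n_gt0 xn0; apply/eqP/freeg_eqP => a.
have /eqP := congr1 (coeff a) xn0.
rewrite coeffMn coeff0 -mulr_natr mulf_eq0 pnatr_eq0 eqn0Ngt n_gt0 orbF.
by move/eqP.
Qed.

Lemma torsion_free_inj (U V : zmodType) (h : {additive U -> V}) :
  injective h -> torsion_free V -> torsion_free U.
Proof.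
move=> h_inj tfV x n n_gt0 xn0; apply: h_inj; rewrite raddf0.
by apply: tfV n_gt0 _; rewrite -raddfMn xn0 raddf0.
Qed.

Lemma quot_pi_eq0 (V : zmodType) (H : zmodClosed V) x :
  (\pi_(Quotient.quot H) x == 0) = (x \in H).
Proof. by rewrite -[x in RHS]subr0 Quotient.idealrBE raddf0. Qed.

Lemma torsion_free_mod_torsion (V : zmodType) : torsion_free (mod_torsion V).
Proof.
rewrite /mod_torsion => x n n_gt0; rewrite -[x]reprK -raddfMn /= => /eqP.
rewrite quot_pi_eq0 => /asboolP[m m_gt0]; rewrite -mulrnA => xnm0.
apply/eqP; rewrite quot_pi_eq0; apply/asboolP.
by exists (n * m)%N; rewrite ?muln_gt0 ?n_gt0.
Qed.

Lemma freeg_lift (X : choiceType) (V : zmodType) (f : X -> V) :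
  exists h : {additive {freeg X} -> V}, forall x, h << x >> = f x.
Proof.
(* [fglift] expects a module as target, so [V] is viewed as a module over the integers. *)
pose g : {freeg X} -> V := @fglift int (zmodule V) X f.
have g_additive : additive g := lift_is_additive (M := zmodule V) f.
pose m := GRing.isAdditive.Build {freeg X} V g g_additive.
pose h : {additive {freeg X} -> V} := HB.pack g m.
by exists h => x; rewrite /= /g liftU scale1r.
Qed.

Lemma freeg_gen_ind (X : choiceType) (P : {freeg X} -> Prop) :
  P 0 -> (forall x y, P x -> P y -> P (x - y)) -> (forall x, P << x >>) ->
  forall D, P D.
Proof.
move=> P0 PB PX D.
apply: (@in_span_ind _ (fun y => exists x, y = << x >>)) => //.
  by move=> _ [x ->].
rewrite -(freeg_sumE D); apply: rpred_sum => x _.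
have <- : << x >> *~ coeff x D = << coeff x D *g x >>.
  by rewrite freegU_mulz intz.
by apply: rpredMz; apply: mem_subgroup_gen; exists x.
Qed.

Lemma quot_lift (U V : zmodType) (H : zmodClosed U) (h : {additive U -> V}) :
  (forall x, x \in H -> h x = 0) ->
  exists k : {additive Quotient.quot H -> V},
    forall x, k (\pi_(Quotient.quot H) x) = h x.
Proof.
(* Two representatives of a class differ by an element of [H], which [h] kills. *)
move=> hH; pose g (x : Quotient.quot H) := h (repr x).
have g_pi x : g (\pi_(Quotient.quot H) x) = h x.
  apply/eqP; rewrite -subr_eq0 -raddfB; apply/eqP/hH.
  by rewrite Quotient.idealrBE reprK.
have g_additive : additive g.
  by move=> x y; rewrite -[x]reprK -[y]reprK -raddfB /= !g_pi raddfB.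
pose m := GRing.isAdditive.Build (Quotient.quot H) V g g_additive.
pose k : {additive Quotient.quot H -> V} := HB.pack g m.
by exists k.
Qed.

(** The relations are tested on an arbitrary additive extension of [f], since the extension used is
    known only through its values on generators. *)
Lemma presented_lift (X : choiceType) (R : {freeg X} -> Prop) (V : zmodType)
    (f : X -> V) :
  (forall h : {additive {freeg X} -> V}, (forall x, h << x >> = f x) ->
    forall r, R r -> h r = 0) ->
  exists k : {additive presented R -> V},
    forall x, k (presented_gen R x) = f x.
Proof.
move=> fR; have [h hf] := freeg_lift f.
have [k kh] : exists k : {additive presented R -> V},
    forall x, k (\pi_(presented R) x) = h x.
  apply: quot_lift; apply: in_span_ind; first exact: raddf0.
  - by move=> x y hx hy; rewrite raddfB hx hy subrr.
  - exact: fR.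
by exists k => x; rewrite kh.
Qed.

Lemma presented_ind (X : choiceType) (R : {freeg X} -> Prop)
    (P : presented R -> Prop) :
  P 0 -> (forall x y, P x -> P y -> P (x - y)) ->
  (forall x, P (presented_gen R x)) -> forall x, P x.
Proof.
rewrite /presented => P0 PB PX x; rewrite -[x]reprK.
move: (repr x); apply: freeg_gen_ind => //.
- by rewrite raddf0.
- by move=> y z Py Pz; rewrite raddfB; apply: PB.
Qed.

Lemma presented_rel0 (X : choiceType) (R : {freeg X} -> Prop) r :
  R r -> \pi_(presented R) r = 0.
Proof.
move=> Rr; apply/eqP; rewrite quot_pi_eq0; exact: mem_subgroup_gen.
Qed.

Lemma mod_torsion_lift (U V : zmodType) (h : {additive U -> V}) :
  torsion_free V ->
  exists k : {additive mod_torsion U -> V}, forall x, k (to_mod_torsion x) = h x.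
Proof.
move=> tfV; apply: quot_lift => x /asboolP[n n_gt0 xn0].
by apply: tfV n_gt0 _; rewrite -raddfMn xn0 raddf0.
Qed.

Lemma injective_surjective_bijective (S T : Type) (f : S -> T) :
  injective f -> (forall y, exists x, f x = y) -> bijective f.
Proof.
move=> f_inj f_surj; pose g y := projT1 (cid (f_surj y)).
have gK : cancel g f by move=> y; rewrite /g; case: cid.
by exists g => // x; apply: f_inj; rewrite gK.
Qed.

(** * Relations and degrees attached to a Cartan matrix *)

Section CartanGroups.
Variables (I : finType) (C : I -> I -> int) (d : I -> nat).
Hypotheses (hC : gen_cartan C) (hd : symmetrizer C d).

Lemma adj_irrefl i : ~~ adj C i i.
Proof. by have [C2 _ _] := hC; rewrite /adj C2. Qed.

Lemma adj_sym i j : adj C i j -> adj C j i.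
Proof.
move=> ij; have [_ C_le0 C0] := hC.
have ji : j != i by apply: contraTneq ij => ->; exact: adj_irrefl.
rewrite /adj lt_neqAle C_le0 // andbT; apply: contraTneq ij => /C0.
by rewrite /adj => ->; rewrite ltxx.
Qed.

Lemma swapgK i j : cancel (@swapg I C i j) (@swapg I C j i).
Proof. by move=> g; apply: val_inj. Qed.

Lemma fdiv_gt0 i j : adj C i j -> (0 < fdiv C i j)%N.
Proof.
rewrite /adj => ij; have Cij : (0 < `|C i j|)%N by rewrite absz_gt0 lt_eqF.
by rewrite divn_gt0 ?gcdn_gt0 ?Cij // dvdn_leq ?dvdn_gcdl.
Qed.

Lemma mu_swap i j (ij : adj C i j) (ji : adj C j i) (g : 'I_(gmul C i j)) :
  mu ij g + mu ji (swapg g) = 0.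
Proof.
rewrite -raddfD; apply: presented_rel0.
by exists i, j, ij, ji, g.
Qed.

(* Choosing one generator out of each pair of opposite mu's, by an ordering of
   I, exhibits Gamma as a retract of a free abelian group. *)
Lemma torsion_free_Gamma : torsion_free (Gamma C).
Proof.
pose lt_I (i j : I) := (enum_rank i < enum_rank j)%N.
pose F : zmodType := {freeg grading_gen C}.
pose f (a : grading_gen C) : F :=
  match a with
  | GenMu i j ij g => if lt_I i j then << GenMu ij g >>
                      else - << GenMu (adj_sym ij) (swapg g) >>
  | GenQ => << GenQ C >>
  | GenT => << GenT C >>
  end.
have [h hE] : exists h : {additive Gamma C -> F},
    forall a, h (presented_gen _ a) = f a.
  apply: presented_lift => h hE _ [i [j [ij [ji [g ->]]]]].
  rewrite raddfD /= !hE /= (bool_irrelevance (adj_sym ij) ji).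
  rewrite (bool_irrelevance (adj_sym ji) ij) swapgK.
  rewrite /lt_I; case: ltngtP => [||/val_inj/enum_rank_inj eq_ij].
  - by rewrite subrr.
  - by rewrite addNr.
  (* The case [i = j] cannot occur: the diagonal entries are 2, so no vertex is adjacent to
     itself. *)
  - by move: (adj_irrefl i); rewrite {2}eq_ij ij.
have [s sE] := freeg_lift (@presented_gen _ (@Gamma_rel I C)).
apply: (@torsion_free_inj _ _ h); last exact: torsion_free_freeg.
apply: (can_inj (g := s)).
apply: presented_ind; first by rewrite !raddf0.
  by move=> x y hx hy; rewrite !raddfB hx hy.
move=> [||i j ij g]; rewrite hE /= ?sE //.
case: ifP => _; rewrite ?raddfN /= sE //.
by apply/esym/eqP; rewrite -addr_eq0; apply/eqP/mu_swap.
Qed.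

Lemma bracket_ind (P : Gtilde_f C -> Prop) :
  P 0 -> (forall x y, P x -> P y -> P (x - y)) -> (forall a, P (bracket a)) ->
  forall x, P x.
Proof.
rewrite /Gtilde_f /mod_torsion => P0 PB Pa x; rewrite -[x]reprK.
move: (repr x); apply: presented_ind => //.
- by rewrite raddf0.
- by move=> y z Py Pz; rewrite raddfB; apply: PB.
Qed.

Lemma bracket_potential : exists T : Gtilde_f C,
  forall i j (ij : adj C i j) (ji : adj C j i) (g : 'I_(gmul C i j)),
    bracket (Alpha ij g) + bracket (Alpha ji (swapg g))
      + bracket (Eps C i) *+ fdiv C i j = T.
Proof.
pose p (x : {freeg arrow C}) := to_mod_torsion (\pi_(Gtilde C) x).
have termE i j (ij : adj C i j) (ji : adj C j i) (g : 'I_(gmul C i j)) :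
    bracket (Alpha ij g) + bracket (Alpha ji (swapg g))
      + bracket (Eps C i) *+ fdiv C i j = p (potential_term ij ji g).
  by rewrite /p /potential_term /to_mod_torsion !raddfD !raddfMn.
have [[i [j [ij [ji [g _]]]]] | none] :=
  pselect (exists i j (ij : adj C i j) (ji : adj C j i) (g : 'I_(gmul C i j)), True).
  exists (p (potential_term ij ji g)) => i' j' ij' ji' g'.
  rewrite termE; apply/eqP; rewrite -subr_eq0 -!raddfB /=.
  rewrite presented_rel0 ?raddf0 //.
  by exists i', j', ij', ji', g', i, j, ij, ji, g.
(* Without edges the claim is vacuous, and 0 is an arbitrary choice of [T]. *)
exists 0 => i j ij ji g; case: none.
by exists i, j, ij, ji, g.
Qed.

(** This is the symmetry of DC in absolute value, divided by the common gcd g_ij = g_ji. *)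
Lemma symmetrizer_fdiv i j : (d i * fdiv C i j = d j * fdiv C j i)%N.
Proof.
have [_ dC] := hd; have := congr1 absz (dC i j).
rewrite !abszM !absz_nat /fdiv (gmulC C j i) => dC_abs.
have gi : (gmul C i j %| `|C i j|)%N by exact: dvdn_gcdl.
have gj : (gmul C i j %| `|C j i|)%N by exact: dvdn_gcdr.
by rewrite !muln_divA // dC_abs.
Qed.

Lemma bracket_Eps_adj i j (ij : adj C i j) :
  bracket (Eps C i) *+ fdiv C i j = bracket (Eps C j) *+ fdiv C j i.
Proof.
have ji := adj_sym ij; have [T TE] := bracket_potential.
have [g] : exists g : 'I_(gmul C i j), True.
  suff g_gt0 : (0 < gmul C i j)%N by exists (Ordinal g_gt0).
  by rewrite gcdn_gt0 absz_gt0 lt_eqF.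
(* The terms for (i, j) and (j, i) contain the same two arrows, which cancel and leave only the
   loops. *)
have := TE j i ji ij (swapg g).
rewrite swapgK -(TE i j ij ji g) (addrC (bracket (Alpha ji _))).
by move/addrI.
Qed.

(** The opposite mu's cancel, and the exponent of q is - d_i f_ij - d_j f_ji + 2 d_i f_ij = 0. *)
Lemma deg_potential i j (ij : adj C i j) (ji : adj C j i)
    (g : 'I_(gmul C i j)) :
  deg d (Alpha ij g) + deg d (Alpha ji (swapg g))
    + deg d (Eps C i) *+ fdiv C i j = t C *+ 2.
Proof.
rewrite /= (symmetrizer_fdiv j i) -mulrnA -mulnA (mulrnA _ 2) mulrnAC.
set Q := q C *+ _; rewrite (addrACA (- Q + _)) mu_swap addr0 (addrACA (- Q)).
by rewrite -opprD -!mulr2n (addrAC (- _)) addNr add0r.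
Qed.

Hypothesis hirr : irreducible_cartan C.

Lemma bracket_Eps_proportional i j :
  bracket (Eps C i) *+ d j = bracket (Eps C j) *+ d i.
Proof.
have tf := @torsion_free_mod_torsion (Gtilde C).
have [d_gt0 _] := hd.
have {}tf (x y : Gtilde_f C) n : (0 < n)%N -> x *+ n = y *+ n -> x = y.
  by move=> n_gt0 xy; apply/subr0_eq/(tf _ n n_gt0); rewrite mulrnBl xy subrr.
have /connectP[p] := hirr i j.
elim: p i => [|k p IHp] i /=; first by move=> _ ->.
case/andP=> ik kp lastE; have IH := IHp k kp lastE.
have ik_rel : bracket (Eps C i) *+ d k = bracket (Eps C k) *+ d i.
  (* After multiplication by f_ik, the identity d_i f_ik = d_k f_ki reduces the claim to the
     relation between adjacent loops. *)
  apply: (tf _ _ (fdiv C i k)); first exact: fdiv_gt0.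
  rewrite -!mulrnA symmetrizer_fdiv mulnC mulrnA bracket_Eps_adj //.
  by rewrite -mulrnA mulnC.
(* Multiplying by d_k lets the edge relation and the induction hypothesis be chained through
   [eps_k]. *)
apply: (tf _ _ (d k)) => //.
by rewrite mulrnAC ik_rel mulrnAC IH mulrnAC.
Qed.

(* Over the rationals, deg has the inverse q |-> [eps_i] / (2 d_i), t |-> T / 2,
   mu_ij |-> [alpha_ij] + (f_ij / 2) [eps_i] - T / 2, where T is the common value
   of the potential terms; 2 d_i0 clears the denominators, as
   [eps_i] / d_i does not depend on i. *)
Lemma deg_retraction i0 : exists psi : {additive Gamma C -> Gtilde_f C},
  forall a, psi (deg d a) = bracket a *+ (2 * d i0).
Proof.
have [T TE] := bracket_potential.
pose E := bracket (Eps C i0).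
pose f (a : grading_gen C) : Gtilde_f C :=
  match a with
  | GenQ => E
  | GenT => T *+ d i0
  | GenMu i j ij g =>
      bracket (Alpha ij g) *+ (2 * d i0) + E *+ (d i * fdiv C i j) - T *+ d i0
  end.
have [psi psiE] : exists psi : {additive Gamma C -> Gtilde_f C},
    forall a, psi (presented_gen _ a) = f a.
  apply: presented_lift => h hE _ [i [j [ij [ji [g ->]]]]].
  rewrite raddfD /= !hE /= (symmetrizer_fdiv j i) -/E.
  (* With this, the images of two opposite mu's add up to 2 d_i0 times the difference of a potential
     term and [T], which is 0. *)
  have eps_i : E *+ (d i * fdiv C i j) = bracket (Eps C i) *+ fdiv C i j *+ d i0.
    by rewrite mulrnA -bracket_Eps_proportional mulrnAC.
  rewrite eps_i -(TE i j ij ji g).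
  set x := bracket (Alpha ij g); set y := bracket _; set z := _ *+ fdiv C i j.
  rewrite (addrACA (_ + _)) (addrACA (x *+ _)) -opprD -(mulrnDr z).
  by rewrite -mulrnDr addnn -mul2n -!mulrnDl subrr.
exists psi => -[i j ij g|i] /=.
  rewrite !(raddfD psi) (raddfN psi) (raddfMn psi) /q /t /mu !psiE /= -/E.
  by rewrite [LHS]addrC addrACA addrK addNr addr0.
rewrite raddfMn /q psiE /= mulnC mulrnA -bracket_Eps_proportional.
by rewrite mulnC mulrnA mulrnAC.
Qed.

End CartanGroups.

Theorem proposition3p5 (I : finType) (C : I -> I -> int) (d : I -> nat)
    (hC : gen_cartan C) (hd : symmetrizer C d) (hirr : irreducible_cartan C) :
  exists phi : {additive Gtilde_f C -> Gamma' C d},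
    bijective phi /\
    (forall a : arrow C, subgroup_val (phi (bracket a)) = deg d a).
Proof.
have [d_gt0 _] := hd.
pose S (x : Gamma C) := exists a : arrow C, x = deg d a.
have degS (a : arrow C) : deg d a \in subgroup_gen S.
  by apply: mem_subgroup_gen; exists a.
have Gamma'_val_inj : injective (val : Gamma' C d -> Gamma C) by exact: val_inj.
have [phi0 phi0E] : exists k : {additive Gtilde C -> Gamma' C d},
    forall a, k (presented_gen _ a) = Subgroup (degS a).
  apply: presented_lift => h hE r.
  have potE i j (ij : adj C i j) (ji : adj C j i) (g : 'I_(gmul C i j)) :
      subgroup_val (h (potential_term ij ji g)) = t C *+ 2.
    by rewrite -[subgroup_val _]/(val _) /potential_term !raddfD !raddfMn /=
               !hE deg_potential.
  move=> [i1 [j1 [ij1 [ji1 [g1 [i2 [j2 [ij2 [ji2 [g2 ->]]]]]]]]]].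
  by apply: Gamma'_val_inj; rewrite (raddfB h) [LHS]raddfB /= !potE subrr.
have tf_Gamma' : torsion_free (Gamma' C d).
  by apply: torsion_free_inj Gamma'_val_inj _; exact: torsion_free_Gamma.
have [phi phiE] := mod_torsion_lift phi0 tf_Gamma'.
have degE a : subgroup_val (phi (bracket a)) = deg d a.
  by rewrite phiE phi0E.
exists phi; split=> //.
apply: injective_surjective_bijective; last first.
  case=> x xS; suff [y yx] : exists y, subgroup_val (phi y) = x.
    by exists y; apply: val_inj.
  (* Surjectivity: the image is a subgroup containing all degrees of arrows. *)
  move: x xS; apply: in_span_ind.
  - by exists 0; rewrite (raddf0 phi).
  - by move=> _ _ [x <-] [y <-]; exists (x - y); rewrite (raddfB phi).
  - by move=> _ [a ->]; exists (bracket a).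
(* The retraction needs a base vertex; if [I] is empty there are no arrows, so the source is
   trivial. *)
have [[i0] | noI] := pselect (inhabited I); last first.
  have zero (x : Gtilde_f C) : x = 0.
    elim/bracket_ind: x => // [x y -> ->|[i|i]]; first exact: subrr.
    - by case: noI; exists.
    - by case: noI; exists.
  by move=> x y _; rewrite (zero x) (zero y).
have [psi psiE] := deg_retraction hC hd hirr i0.
have psi_phi x : psi (val (phi x)) = x *+ (2 * d i0).
  elim/bracket_ind: x => [|x y hx hy|a]; last by rewrite [val _]degE.
    by rewrite !raddf0 mul0rn.
  by rewrite !raddfB hx hy mulrnBl.
(* A kernel element is killed by 2 d_i0 > 0, hence vanishes in the torsion-free quotient. *)
apply: raddf_inj => x phix0.
apply: (@torsion_free_mod_torsion _ x (2 * d i0)); first by rewrite muln_gt0 d_gt0.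
by rewrite -psi_phi phix0 !raddf0.
Qed.
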